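(* Let $\alpha$ be an irrational real number with negative continued fraction expansion $\{\alpha\}=[0;a_1,a_2,a_3,\ldots]^-$, and let $R:=\liminf_{i\to\infty} a_i$. If $R$ is odd (in particular finite), then $$\rho(\alpha)\le C(R):=\frac14\left(1-\frac1R\right)\left(1-\frac1{R^2}\right)=\frac14\left(1-\frac1R-\frac1{R^2}+\frac1{R^3}\right).$$
   Context: For real $x$, $\|x\|$ denotes the distance from $x$ to the nearest integer and $\{x\}$ the fractional part. For irrational $\alpha$ and real $\gamma\in[0,1)$ define the inhomogeneous approximation constant $M(\alpha,\gamma):=\liminf_{|n|\to\infty}|n|\,\|n\alpha-\gamma\|$ (over integers $n$), and $\rho(\alpha):=\sup_{\gamma\in[0,1),\ \gamma\notin\mathbb Z+\mathbb Z\alpha} M(\alpha,\gamma)$. The negative (''round-up'') continued fraction expansion is generated by $\alpha_0:=\{\alpha\}$, $a_{n+1}:=\lceil 1/\alpha_n\rceil$, $\alpha_{n+1}:=\lceil 1/\alpha_n\rceil-1/\alpha_n$; the integers $a_i\ge 2$ are the partial quotients and one writes $\{\alpha\}=[0;a_1,a_2,\ldots]^-=\cfrac{1}{a_1-\cfrac{1}{a_2-\cdots}}$. *)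

(* Defs.v *)
From mathcomp Require Export all_boot all_order all_algebra.
From mathcomp Require Export all_classical all_reals all_analysis.

Set Implicit Arguments.
Unset Strict Implicit.
Unset Printing Implicit Defensive.
Import Order.TTheory GRing.Theory Num.Theory.

Local Open Scope classical_set_scope.
Local Open Scope ring_scope.

Definition frac (R : realType) (x : R) : R := x - (Num.floor x)%:~R.

Definition dist_int (R : realType) (x : R) : R :=
  inf [set `|x - m%:~R| | m in [set: int]].

(* liminf as |n| -> oo, over positive and negative integers n alike:
   sup over N of the inf over |n| >= N. *)
Definition limn_einf_absz (R : realType) (u : int -> \bar R) : \bar R :=
  ereal_sup [set ereal_inf [set u n | n in [set n : int | (N <= `|n|)%N]]
            | N in [set: nat]].

Definition inhom_const (R : realType) (alpha gamma : R) : \bar R :=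
  limn_einf_absz (fun n : int =>
    (`|n%:~R| * dist_int (n%:~R * alpha - gamma))%:E).

Definition rho (R : realType) (alpha : R) : \bar R :=
  ereal_sup [set inhom_const alpha gamma | gamma in
    [set g : R | 0 <= g < 1 /\
                 ~ exists p q : int, g = p%:~R + q%:~R * alpha]].

Fixpoint ncf_rem (R : realType) (alpha : R) (n : nat) : R :=
  if n is n'.+1
  then (Num.ceil (ncf_rem alpha n')^-1)%:~R - (ncf_rem alpha n')^-1
  else frac alpha.

(* The indexing is shifted: [ncf_quot alpha n] is a_{n+1}, so that the whole
   sequence a_1, a_2, ... is enumerated from n = 0. *)
Definition ncf_quot (R : realType) (alpha : R) (n : nat) : int :=
  Num.ceil (ncf_rem alpha n)^-1.

Definition C_bound (R : realType) (r : R) : R :=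
  4^-1 * (1 - r^-1) * (1 - (r ^+ 2)^-1).

(* Main.v *)
Require Import Defs.
From mathcomp Require Import all_boot all_order all_algebra.
From mathcomp Require Import all_classical all_reals all_analysis.
From mathcomp Require Import ring lra zify.
Import Order.TTheory GRing.Theory Num.Theory.

Local Open Scope ring_scope.

(* Let q_i be the denominators of the convergents p_i / q_i of alpha,
   D_i = q_i alpha - p_i > 0, and consider an index i with a_(i+1) = R = a.
   The points (n, n alpha - m - gamma), scaled by q_i horizontally and by D_i
   vertically, form a translate of the lattice spanned by (1, 1) and (t, a - s),
   where s = alpha_(i+1) and t = q_(i-1) / q_i; its covolume is
   a - s - t = 1 / (q_i D_i).  So it suffices to find in every such translate a
   point with |x y| <= C(a) (a - s - t) and |y| bounded: since D_i tends to 0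
   and gamma is not in Z + Z alpha, boundedness of |y| forces |n| to tend to
   infinity along the indices i.  As a_j >= 3 eventually, s, t <= 2/5.

   Two consecutive lines of the translate in direction (1, 1) lie on either side
   of the origin.  On each, only the points next to the two coordinate axes
   matter.  If e1, e2 and f1, f2 are the distances from the axes, along the two
   lines, to the next points between the axes, then in the main case
   e1 + f1 = 1 - t and e2 + f2 = 1 - s, and the lengths cut out by the axes are
   m + e1 + e2 and n + f1 + f2 with m + n = a - 2.  This is where the parity of a
   enters: m and n are integers with an odd sum, hence distinct. *)

(** * Inequalities for the constant and for the points of a line *)

(** [16 / 27] is the value of [4 * C_bound a] at [a = 3]. The last bound comes from
    [4 * C_bound a * a = a - 1 - 1/a + 1/a^2] and [1/a <= 1/3]. *)
Lemma C_bound_estimates (R : realType) (a : R) : 3 <= a ->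
  [/\ 16 / 27 <= 4 * C_bound a, 4 * C_bound a <= 1
    & a - 4 / 3 <= 4 * C_bound a * a].
Proof.
move=> a3; have a0 : 0 < a by lra.
have au : a * a^-1 = 1 by rewrite divff ?gt_eqF.
have u0 : 0 < a^-1 by rewrite invr_gt0.
have u3 : a^-1 <= 1 / 3 by rewrite mul1r lef_pV2 ?posrE.
rewrite /C_bound -exprVn; move: au u0 u3; set u := a^-1 => au u0 u3.
have uu : 0 <= u ^+ 2 <= 1 / 9 by apply/andP; split; nra.
split; [nra | nra |].
suff -> : 4 * (4^-1 * (1 - u) * (1 - u ^+ 2)) * a
    = a - a * u - a * u * u + a * u * u ^+ 2 by rewrite au; nra.
by field.
Qed.

(** The cross terms [p * y] and [q * x] have product at least [K^2], so by AM-GM their sum is at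
    least [2 * K]. *)
Lemma min_mul_le (R : realFieldType) (K p q x y : R) :
  0 <= K -> 0 <= p -> 0 <= q -> 0 <= x -> 0 <= y ->
  K <= p * x -> K <= q * y -> 4 * K <= (p + q) * (x + y).
Proof.
move=> K0 p0 q0 x0 y0 px qy.
suff : 2 * K <= p * y + q * x by nra.
rewrite -(@ler_pXn2r _ 2) ?nnegrE; [|by []|nra|nra].
have KK : K * K <= (p * x) * (q * y) by apply: ler_pM.
have := sqr_ge0 (p * y - q * x); nra.
Qed.

(** For [m >= 0] the four products add up to [2 * (m + 1)]. For [m = -1] the first two multiply to
    [e1 (1 - e1) e2 (1 - e2) <= 1/16], against [K >= 1/4]. *)
Lemma short_line (R : realFieldType) (K e1 e2 : R) (m : int) :
  0 <= e1 <= 1 -> 0 <= e2 <= 1 -> -1 <= m -> 1 <= 4 * K ->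
  K < `|e1 * (m%:~R + e2)| -> K < `|e2 * (m%:~R + e1)| ->
  K < `|(1 - e1) * (m%:~R + 1 + e2)| ->
  K < `|(1 - e2) * (m%:~R + 1 + e1)| ->
  2 * K < m%:~R + 1.
Proof.
move=> /andP[e10 e11] /andP[e20 e21] m1 K1.
have [-> {m m1}|mN1] := eqVneq m (-1).
  have e1e2 : e1 * ((-1)%:~R + e2) <= 0 by nra.
  have e2e1 : e2 * ((-1)%:~R + e1) <= 0 by nra.
  rewrite (ler0_norm e1e2) (ler0_norm e2e1) => h1 h2 _ _.
  have := @ltr_pM _ K (- (e1 * (-1 + e2))) K (- (e2 * (-1 + e1))).
  have -> : - (e1 * (-1 + e2)) * - (e2 * (-1 + e1)) = (e1 * (1 - e1)) * (e2 * (1 - e2)) by ring.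
  have : 0 <= e1 * (1 - e1) <= 1/4 by have := sqr_ge0 (2 * e1 - 1); nra.
  have : 0 <= e2 * (1 - e2) <= 1/4 by have := sqr_ge0 (2 * e2 - 1); nra.
  move=> /andP[? ?] /andP[? ?] h; exfalso.
  have {}h : K * K < 1/16 by apply: lt_le_trans; [apply: h => //; lra|nra].
  nra.
have m0 : 0 <= m%:~R :> R by rewrite ler0z; lia.
rewrite !ger0_norm; try (by apply: mulr_ge0; lra).
move=> h1 h2 h3 h4; lra.
Qed.

(** Averaging each pair of bounds replaces [e1, e2] by their mean [z] and [f1, f2] by
    [w = 1 - g - z]. One resulting bound grows with [z] and the other decreases, so [K] lies below
    their common value [V]. *)
Lemma long_lines (R : realType) (A K s t e1 e2 f1 f2 : R) :
  let a := 2 * A + 1 in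
  1 <= A -> 0 <= s <= 2 / 5 -> 0 <= t <= 2 / 5 ->
  0 <= e1 -> 0 <= e2 -> 0 <= f1 -> 0 <= f2 ->
  e1 + f1 = 1 - t -> e2 + f2 = 1 - s ->
  K < e1 * (A - 1 + e2) -> K < e2 * (A - 1 + e1) ->
  K < f1 * (A + f2) -> K < f2 * (A + f1) ->
  K < C_bound a * (a - s - t).
Proof.
move=> a A1 /andP[s0 s1] /andP[t0 t1] e10 e20 f10 f20 h1 h2 k1 k2 k3 k4.
pose g := (s + t) / 2; pose D := a - 2 * g.
pose z := (e1 + e2) / 2; pose w := (f1 + f2) / 2.
have kz : K < z * (A - 1 + z) by have := sqr_ge0 (e1 - e2); rewrite /z; nra.
have kw : K < w * (A + w) by have := sqr_ge0 (f1 - f2); rewrite /w; nra.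
have gzw : z + w = 1 - g by rewrite /z /w /g; lra.
have g01 : 0 <= g <= 2 / 5 by rewrite /g; lra.
have z0 : 0 <= z by rewrite /z; lra.
have w0 : 0 <= w by rewrite /w; lra.
have D2 : 11 / 5 <= D by rewrite /D /a; lra.
have a3 : 3 <= a by rewrite /a; lra.
(* The two bounds [kz] and [kw] balance at [z = v]. *)
pose v := (1 - g) * (D + 1) / (2 * D).
pose V := v * (A - 1 + v).
have v0 : 0 <= v by rewrite /v; apply: divr_ge0; nra.
have vE : V = (1 - g - v) * (A + 1 - g - v).
  rewrite /V /v /D /a; field; move: D2; rewrite /D /a; lra.
have vg : v <= 1 - g.
  rewrite /v ler_pdivrMr; nra.
have KV : K < V.
  have [zv|vz] := leP z v.
    by apply: lt_le_trans kz _; rewrite /V; apply: ler_pM; lra.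
  apply: lt_le_trans kw _; rewrite vE; apply: ler_pM; lra.
apply: lt_le_trans KV _.
have -> : a - s - t = D by rewrite /D /g; lra.
(* This factorization parallels [C_bound a * D] and is compared with it factor by factor; the two
   agree at [g = 0]. *)
have -> : V = 4^-1 * ((1 - g) * (a - 1 - g) / D) * (1 - (D ^+ 2)^-1) * D.
  rewrite /V /v (_ : A = (D + 2 * g - 1) / 2); last by rewrite /D /a; lra.
  have -> : a = D + 2 * g by rewrite /D; lra.
  by field; lra.
rewrite ler_wpM2r //; first by lra.
rewrite /C_bound -[leLHS]mulrA -[leRHS]mulrA ler_wpM2l //.
have a_neq0 : a != 0 by rewrite gt_eqF //; lra.
apply: ler_pM.
- by rewrite divr_ge0 //; nra.
- rewrite subr_ge0 invf_le1; nra.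
- rewrite ler_pdivrMr; last lra.
  have -> : (1 - a^-1) * D = (a - 1) * D / a by field.
  rewrite ler_pdivlMr; last lra.
  rewrite -subr_ge0.
  have -> : (a - 1) * D - (1 - g) * (a - 1 - g) * a
      = g * (a * (a - 2 - g) + 2) by rewrite /D; ring.
  have ag : 0 <= a * (a - 2 - g) by apply: mulr_ge0; lra.
  by apply: mulr_ge0; lra.
- rewrite lerD2l lerN2 lef_pV2 ?posrE; [|nra|nra].
  by rewrite ler_pXn2r ?nnegrE //; rewrite /D; lra.
Qed.

(* The points of the line [x - y = d] that are adjacent to the axes: [e1] and
   [e2] are the fractional parts of [x] and of [- y]. *)
Lemma line_points (R : realFieldType) (B K d e1 e2 : R) (m : int) :
  0 <= e1 <= 1 -> 0 <= e2 <= 1 -> 0 <= d <= B -> d = m%:~R + e1 + e2 ->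
  (forall k : int, `|e1 + k%:~R - d| <= B + 1 ->
     K < `|(e1 + k%:~R) * (e1 + k%:~R - d)|) ->
  [/\ K < `|e1 * (m%:~R + e2)|, K < `|e2 * (m%:~R + e1)|,
      K < `|(1 - e1) * (m%:~R + 1 + e2)|
    & K < `|(1 - e2) * (m%:~R + 1 + e1)| ].
Proof.
move=> /andP[e10 e11] /andP[e20 e21] /andP[d0 dB] dE H.
have normB (y : R) : - (B + 1) <= y -> y <= B + 1 -> `|y| <= B + 1.
  by move=> ? ?; rewrite ler_norml; apply/andP.
split.
- have -> : `|e1 * (m%:~R + e2)| = `|(e1 + 0%:~R) * (e1 + 0%:~R - d)|.
    by rewrite -normrN; congr `|_|; rewrite dE; ring.
  by apply: H; apply: normB; lra.
- have -> : `|e2 * (m%:~R + e1)| = `|(e1 + m%:~R) * (e1 + m%:~R - d)|.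
    by rewrite -normrN; congr `|_|; rewrite dE; ring.
  by apply: H; apply: normB; lra.
- have -> : (1 - e1) * (m%:~R + 1 + e2)
      = (e1 + (-1)%:~R) * (e1 + (-1)%:~R - d) by rewrite dE; ring.
  by apply: H; apply: normB; lra.
- have -> : (1 - e2) * (m%:~R + 1 + e1)
      = (e1 + (m + 1)%:~R) * (e1 + (m + 1)%:~R - d) by rewrite dE; ring.
  by apply: H; apply: normB; rewrite intrD; lra.
Qed.

(** Passing to the neighbouring line, reflected through the origin, turns the offset [e] into
    [j - e - t]; [j = 1] is the main case. *)
Lemma reflect_offset (R : realFieldType) (e t : R) :
  0 <= e <= 1 -> 0 <= t <= 1 ->
  exists j : int, (j = 1 \/ j = 2) /\ 0 <= j%:~R - e - t <= 1.
Proof.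
move=> /andP[e0 e1] /andP[t0 t1]; have [et|et] := leP (e + t) 1.
  by exists 1; split; [left | apply/andP; split; lra].
by exists 2; split; [right | apply/andP; split; lra].
Qed.

(* Outside the main case, two outer points on the same axis are at a total
   distance of only [t] from it. *)
Lemma wrapped_lines (R : realFieldType) (C a K s t e f x y : R) :
  3 <= a -> 16 / 27 <= C -> 4 * K = C * (a - s - t) ->
  0 <= s <= 2 / 5 -> 0 <= t <= 2 / 5 ->
  0 <= e <= 1 -> 0 <= f <= 1 -> 0 <= x -> 0 <= y ->
  (1 - e) + (1 - f) = t -> x + y = a - s ->
  K < `|(1 - e) * x| -> K < `|(1 - f) * y| -> False.
Proof.
move=> a3 CE KE /andP[s0 s1] /andP[t0 t1] /andP[e0 e1] /andP[f0 f1] x0 y0.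
move=> ef xy.
have Kge : 16 / 27 * (a - s - t) <= 4 * K by rewrite KE; apply: ler_wpM2r; lra.
rewrite ger0_norm; last by apply: mulr_ge0; lra.
move=> kx; rewrite ger0_norm; last by apply: mulr_ge0; lra.
move=> ky.
(* This yields [4 K <= t (a - s) <= 2/5 (a - s)], which is less than [16/27 (a - s - t)]. *)
have := @min_mul_le R K (1 - e) (1 - f) x y.
rewrite ef xy => /(_ _ _ _ x0 y0 (ltW kx) (ltW ky)) h.
have {}h : 4 * K <= t * (a - s) by apply: h; lra.
have : t * (a - s) <= 2 / 5 * (a - s) by apply: ler_wpM2r; lra.
lra.
Qed.

Lemma ge_N1_offset (R : realFieldType) (m : int) (d e1 e2 : R) :
  d = m%:~R + e1 + e2 -> e1 + e2 < d + 2 -> -1 <= m.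
Proof.
move=> dE e12.
by rewrite -[leLHS](addrK 1) lerBlDr -ltzD1 -(ltr_int R) !intrD; lra.
Qed.

(** * Two consecutive lines of the lattice translate *)

Lemma two_lines (R : realType) (A m n j1 j2 : int) (s t d d' e1 e2 f1 f2 : R) :
  let a := 2 * A%:~R + 1 in
  let K := C_bound a * (a - s - t) in
  1 <= A -> 0 <= s <= 2 / 5 -> 0 <= t <= 2 / 5 ->
  0 <= e1 <= 1 -> 0 <= e2 <= 1 -> 0 <= f1 <= 1 -> 0 <= f2 <= 1 ->
  -1 <= m -> -1 <= n -> d = m%:~R + e1 + e2 -> d' = n%:~R + f1 + f2 ->
  0 <= d -> 0 <= d' -> d + d' = a - s - t ->
  j1 = 1 \/ j1 = 2 -> j2 = 1 \/ j2 = 2 ->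
  e1 + f1 = j1%:~R - t -> e2 + f2 = j2%:~R - s ->
  [/\ K < `|e1 * (m%:~R + e2)|, K < `|e2 * (m%:~R + e1)|,
      K < `|(1 - e1) * (m%:~R + 1 + e2)|
    & K < `|(1 - e2) * (m%:~R + 1 + e1)| ] ->
  [/\ K < `|f1 * (n%:~R + f2)|, K < `|f2 * (n%:~R + f1)|,
      K < `|(1 - f1) * (n%:~R + 1 + f2)|
    & K < `|(1 - f2) * (n%:~R + 1 + f1)| ] -> False.
Proof.
move=> a K A1 s01 t01 e1I e2I f1I f2I mN1 nN1 dE d'E d0 d'0 dd' j1E j2E ef1 ef2.
have A1R : 1 <= A%:~R :> R by rewrite ler1z.
have aE : a = 2 * A%:~R + 1 by [].
have a3 : 3 <= a by rewrite aE; lra.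
have [c1 c2 c3] := C_bound_estimates R a a3.
have KE : 4 * K = 4 * C_bound a * (a - s - t) by rewrite /K mulrA.
have [s0 s1] := andP s01; have [t0 t1] := andP t01.
move=> [ie1 ie2 oe1 oe2] [if1 if2 of1 of2].
have j11 : j1 = 1.
  case: j1E => // j12; exfalso; rewrite j12 in ef1.
  apply: (@wrapped_lines R (4 * C_bound a) a K s t e1 f1 (m%:~R + 1 + e2) (n%:~R + 1 + f2))
    => //; clear -dE d'E d0 d'0 dd' ef1 e1I f1I; lra.
have j21 : j2 = 1.
  case: j2E => // j22; exfalso; rewrite j22 in ef2.
  (* Exchanging the axes swaps [s] and [t]. *)
  rewrite addrAC in KE.
  apply: (@wrapped_lines R (4 * C_bound a) a K t s e2 f2 (m%:~R + 1 + e1) (n%:~R + 1 + f1))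
    => //; clear -dE d'E d0 d'0 dd' ef2 e2I f2I; lra.
rewrite {}j11 in ef1; rewrite {}j21 in ef2.
have K1 : 1 <= 4 * K.
  rewrite KE; apply: (@le_trans _ _ (16 / 27 * (11 / 5))).
    by clear; lra.
  by apply: ler_pM => //; clear -a3 s1 t1; lra.
(* As [a = 2 A + 1], this says [A - 1 <= 2 K], so [short_line] excludes integer parts up to
   [A - 2]. *)
have K2 : a - 3 <= 4 * K.
  have : 4 * C_bound a * (s + t) <= s + t.
    by apply: ler_piMl => //; clear -s0 t0; lra.
  by rewrite KE; clear -c3 s1 t1; lra.
have short (k : int) : k <= A - 2 -> ~ 2 * K < k%:~R + 1.
  by rewrite -(ler_int R) intrB; clear -K2 aE => ? ?; lra.
have long (k l : int) (g1 g2 h1 h2 : R) : k = A - 1 -> l = A ->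
    0 <= g1 <= 1 -> 0 <= g2 <= 1 -> 0 <= h1 <= 1 -> 0 <= h2 <= 1 ->
    g1 + h1 = 1 - t -> g2 + h2 = 1 - s ->
    K < `|g1 * (k%:~R + g2)| -> K < `|g2 * (k%:~R + g1)| ->
    K < `|h1 * (l%:~R + h2)| -> K < `|h2 * (l%:~R + h1)| -> False.
  move=> -> -> /andP[g10 _] /andP[g20 _] /andP[h10 _] /andP[h20 _] gh1 gh2.
  rewrite intrB !ger0_norm;
    try (by apply: mulr_ge0 => //; clear -g10 g20 h10 h20 A1R; lra).
  move=> k1 k2 k3 k4.
  have : K < K by apply: (@long_lines R A%:~R K s t g1 g2 h1 h2).
  by rewrite ltxx.
(* As m + n = 2 A - 1, either one of them is at most A - 2 or they are A - 1
   and A in some order. *)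
have [mA|mA] := leP m (A - 2).
  by apply: (short m) => //; apply: (@short_line R K e1 e2).
have [nA|nA] := leP n (A - 2).
  by apply: (short n) => //; apply: (@short_line R K f1 f2).
have mn : m + n = 2 * A - 1.
  apply/eqP; rewrite -(eqr_int R) intrD intrB intrM; apply/eqP.
  by clear -dE d'E dd' ef1 ef2 aE; lra.
have [[mE nE]|[mE nE]] : m = A - 1 /\ n = A \/ m = A /\ n = A - 1.
  by clear -mA nA mn; lia.
  by apply: (long m n e1 e2 f1 f2).
by apply: (long n m f1 f2 e1 e2) => //; rewrite addrC.
Qed.

Lemma grid_point (R : realType) (A : int) (s t g : R) :
  let a := 2 * A%:~R + 1 in
  1 <= A -> 0 <= s <= 2 / 5 -> 0 <= t <= 2 / 5 ->
  exists k l : int,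
    `|k%:~R + l%:~R * (a - s) - g| <= a + 1 /\
    `|(k%:~R + l%:~R * t) * (k%:~R + l%:~R * (a - s) - g)|
      <= C_bound a * (a - s - t).
Proof.
move=> a A1 s01 t01; apply: contrapT => noP.
have {noP}H (k l : int) (y : R) : y = k%:~R + l%:~R * (a - s) - g ->
    `|y| <= a + 1 -> C_bound a * (a - s - t) < `|(k%:~R + l%:~R * t) * y|.
  move=> -> yB; rewrite ltNge; apply/negP => h; apply: noP.
  by exists k, l.
have A1R : 1 <= A%:~R :> R by rewrite ler1z.
have [s0 s1] := andP s01; have [t0 t1] := andP t01.
pose D := a - s - t.
have DE : D = a - s - t by [].
have D0 : 0 < D by rewrite DE /a; clear -A1R s1 t1; lra.
(* On the line of index [l], [x - y = g - l D]; this choice puts the origin between the lines [l]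
   and [l + 1]. *)
pose l := Num.floor (g / D).
pose d := g - l%:~R * D.
have /andP[d0 dD] : 0 <= d < D.
  have := floor_itv (g / D); rewrite -/l intrD1 ler_pdivlMr // ltr_pdivrMr //.
  by rewrite mulrDl mul1r /d => /andP[? ?]; apply/andP; split; lra.
pose p := Num.floor (l%:~R * t).
pose e1 := l%:~R * t - p%:~R.
have e1I : 0 <= e1 < 1.
  have := floor_itv (l%:~R * t); rewrite -/p intrD1 /e1 => /andP[? ?].
  by apply/andP; split; lra.
pose m := Num.floor (d - e1).
pose e2 := d - e1 - m%:~R.
have e2I : 0 <= e2 < 1.
  have := floor_itv (d - e1); rewrite -/m intrD1 /e2 => /andP[? ?].
  by apply/andP; split; lra.
have [[e10 e11] [e20 e21]] := (andP e1I, andP e2I).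
have {}e1I : 0 <= e1 <= 1 by rewrite e10 ltW.
have {}e2I : 0 <= e2 <= 1 by rewrite e20 ltW.
have [] := @reflect_offset R e1 t e1I; first by clear -t0 t1; apply/andP; lra.
move=> j1 [j1E f1I].
have [] := @reflect_offset R e2 s e2I; first by clear -s0 s1; apply/andP; lra.
move=> j2 [j2E f2I].
pose f1 := j1%:~R - e1 - t; pose f2 := j2%:~R - e2 - s.
(* The value for which [D - d = n + f1 + f2]; in the main case [m + n = 2 A - 1]. *)
pose n := 2 * A + 1 - m - j1 - j2.
have dE : d = m%:~R + e1 + e2 by rewrite /e2; ring.
have d'E : D - d = n%:~R + f1 + f2.
  by rewrite /n /f1 /f2 DE dE /a !intrB intrD intrM; ring.
have mN1 : -1 <= m.
  by apply: (@ge_N1_offset R _ d e1 e2) => //; clear -e11 e21 d0; lra.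
have j11 : 1 <= j1%:~R :> R by case: j1E => ->; lra.
have j21 : 1 <= j2%:~R :> R by case: j2E => ->; lra.
have d'0 : 0 < D - d by rewrite subr_gt0.
have nN1 : -1 <= n.
  apply: (@ge_N1_offset R _ (D - d) f1 f2) => //.
  have [/andP[_ f11] /andP[_ f21]] := (f1I, f2I).
  by clear -d'0 f11 f21; rewrite /f1 /f2; lra.
apply: (@two_lines R A m n j1 j2 s t d (D - d) e1 e2 f1 f2) => //.
- exact: ltW.
- by rewrite -/a -/D; ring.
- by rewrite /f1; ring.
- by rewrite /f2; ring.
- apply: (@line_points R a _ d) => //.
    by apply/andP; split=> //; clear -dD DE s0 t0; lra.
  move=> k kB.
  have kE : e1 + k%:~R = (k - p)%:~R + l%:~R * t by rewrite intrB /e1; ring.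
  rewrite {1}kE; apply: H => //.
  by rewrite kE /d DE; ring.
- apply: (@line_points R a _ (D - d)) => //.
    by apply/andP; split; [exact: ltW | clear -d0 DE s0 t0; lra].
  (* Reflection through the origin preserves the product of the coordinates. *)
  move=> k kB; rewrite -[X in `|X|]mulrNN.
  have kE : - (f1 + k%:~R) = (- k - j1 - p)%:~R + (l + 1)%:~R * t.
    by rewrite !intrB intrN intrD /f1 /e1; ring.
  rewrite {1}kE; apply: H; last by rewrite normrN.
  by rewrite opprB kE /d DE !intrD; ring.
Qed.

(** * Partial quotients, remainders and denominators *)

(** Integrality sharpens the strict bounds [r - 1 < a n] and [a n < r + 1] supplied by the
    liminf. *)
Lemma limn_einf_int (R : realType) (a : nat -> int) (r : int) :
  limn_einf (fun i => ((a i)%:~R : R)%:E) = (r%:~R : R)%:E ->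
  (forall N, exists n, (N <= n)%N /\ a n <= r) /\
  (exists N, forall n, (N <= n)%N -> r <= a n).
Proof.
set u := (fun i => _); rewrite limn_einf_lim.
rewrite (cvg_lim _ (@cvg_einfs_sup R u)) // => ur; split=> [N|].
- have : (einfs u N < ((r + 1)%:~R : R)%:E)%E.
    apply: (@le_lt_trans _ _ ((r%:~R : R)%:E)).
      by rewrite -ur; apply: ereal_sup_ubound; exists N.
    by rewrite lte_fin ltr_int ltzD1.
  move=> /ereal_inf_lt[_ [n /= Nn <-]]; rewrite lte_fin ltr_int ltzD1 => an.
  by exists n.
- have : (((r - 1)%:~R : R)%:E < ereal_sup (range (einfs u)))%E.
    by rewrite ur lte_fin ltr_int; lia.
  move=> /ereal_sup_gt[_ [N _ <-]] rN; exists N => n Nn.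
  have : (((r - 1)%:~R : R)%:E < u n)%E.
    by apply: lt_le_trans rN _; apply: ereal_inf_lbound; exists n.
  by rewrite lte_fin ltr_int; lia.
Qed.

Lemma ncf_rem_irrational (R : realType) (alpha : R) (n : nat) :
  irrational alpha -> irrational (ncf_rem alpha n).
Proof.
move=> irr; elim: n => [|n IH] /=.
  apply: contra_not irr => -[q _ qE]; exists (q + (Num.floor alpha)%:~R) => //.
  by rewrite rmorphD /= ratr_int qE subrK.
apply: contra_not IH => -[q _ qE].
exists (((Num.ceil (ncf_rem alpha n)^-1)%:~R - q)^-1) => //.
by rewrite fmorphV rmorphB /= ratr_int qE subKr invrK.
Qed.

Lemma irrational_neq0 (R : realType) (x : R) : irrational x -> x != 0.
Proof.
by move=> irr; apply/eqP => x0; apply: irr; exists 0; rewrite // rmorph0 x0.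
Qed.

Lemma ncf_rem_itv (R : realType) (alpha : R) (n : nat) :
  irrational alpha -> 0 < ncf_rem alpha n < 1.
Proof.
move=> irr.
rewrite lt_neqAle eq_sym irrational_neq0 /=; last exact: ncf_rem_irrational.
case: n => [|n] /=.
  have := floor_itv alpha; rewrite intrD1 /Defs.frac => /andP[? ?].
  by apply/andP; split; lra.
have := ceil_itv (ncf_rem alpha n)^-1; rewrite intrB => /andP[? ?].
by apply/andP; split; lra.
Qed.

Lemma ncf_quot_ge2 (R : realType) (alpha : R) (n : nat) :
  irrational alpha -> 2 <= ncf_quot alpha n.
Proof.
move=> /(ncf_rem_itv _ _ n) /andP[x0 x1].
rewrite -[2]/(1 + 1 : int) lezD1 ceil_gt_int.
by rewrite invf_gt1.
Qed.

Lemma ncf_remV (R : realType) (alpha : R) (n : nat) :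
  (ncf_rem alpha n)^-1 = (ncf_quot alpha n)%:~R - ncf_rem alpha n.+1.
Proof. by rewrite /= /ncf_quot subKr. Qed.

(** Two steps of [x = 1 / (a - y)]: from [y < 1] to [1 / (3 - 1)], then to [1 / (3 - 1/2) = 2/5]. *)
Lemma ncf_rem_le (R : realType) (alpha : R) (n : nat) : irrational alpha ->
  3 <= ncf_quot alpha n -> 3 <= ncf_quot alpha n.+1 -> ncf_rem alpha n <= 2 / 5.
Proof.
move=> irr; rewrite -2!(ler_int R) => a0 a1.
have /andP[x0 _] := ncf_rem_itv _ _ n irr.
have /andP[y0 _] := ncf_rem_itv _ _ n.+1 irr.
have /andP[_ z1] := ncf_rem_itv _ _ n.+2 irr.
have Vx := ncf_remV _ alpha n; have Vy := ncf_remV _ alpha n.+1.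
have y2 : ncf_rem alpha n.+1 <= 1 / 2.
  by rewrite -[leLHS]invrK Vy mul1r lef_pV2 ?posrE; lra.
by rewrite -[leLHS]invrK Vx -[2 / 5]invf_div lef_pV2 ?posrE; lra.
Qed.

(* The pair (q_n, q_(n-1)) of consecutive denominators of convergents. *)
Fixpoint ncf_den (a : nat -> int) (n : nat) : int * int :=
  if n is n'.+1
  then (a n' * (ncf_den a n').1 - (ncf_den a n').2, (ncf_den a n').1)
  else (1, 0).

Lemma ncf_den_lt (a : nat -> int) (n : nat) : (forall i, 2 <= a i) ->
  [/\ 0 <= (ncf_den a n).2, (ncf_den a n).2 < (ncf_den a n).1
    & n%:Z < (ncf_den a n).1].
Proof.
move=> a2; elim: n => [//|n [q0 qq nq]] /=; have := a2 n.
move: q0 qq nq; set x := (ncf_den a n).1; set y := (ncf_den a n).2.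
move: (a n) x y => b x y *.
by have := @ler_wpM2r _ x _ 2 b; split; lia.
Qed.

(** The ratios [q_(n-1) / q_n] obey the recursion of the remainders read backwards, whence the same
    bound [2/5]. *)
Lemma ncf_den_le (a : nat -> int) (n : nat) : (forall i, 2 <= a i) ->
  3 <= a n -> 3 <= a n.+1 ->
  5 * (ncf_den a n.+2).2 <= 2 * (ncf_den a n.+2).1.
Proof.
move=> a2 /= an an1; have [q0 qq nq] := ncf_den_lt a n a2.
move: an an1 q0 qq nq; set x := (ncf_den a n).1; set y := (ncf_den a n).2.
move: (a n) (a n.+1) x y => b c x y b3 c3 y0 yx nx.
have bx : 3 * x <= b * x by apply: ler_wpM2r => //; lia.
have : 2 * x <= b * x - y by lia.
move: (b * x - y) => z z0.
have : 3 * z <= c * z by apply: ler_wpM2r => //; lia.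
lia.
Qed.

(** [D * V] is the preceding error [D_(n-1)], and the last equation is the unimodularity
    [q_n D_(n-1) - q_(n-1) D_n = 1]. *)
Lemma ncf_lattice (R : realType) (alpha : R) (n : nat) : irrational alpha ->
  let q := (ncf_den (ncf_quot alpha) n).1 in
  let q' := (ncf_den (ncf_quot alpha) n).2 in
  let V := (ncf_rem alpha n)^-1 in
  exists (D : R) (p p' : int),
    [/\ 0 < D, D = q%:~R * alpha - p%:~R, D * V = q'%:~R * alpha - p'%:~R
      & D * (q%:~R * V - q'%:~R) = 1].
Proof.
move=> irr; elim: n => [|n [D [p [p' [D0 DE DV det]]]]].
  have /andP[x0 _] := ncf_rem_itv _ _ 0 irr.
  (* [p' = -1] makes the error before the first one equal to 1. *)
  exists (Defs.frac alpha), (Num.floor alpha), (-1); rewrite /= in x0 *.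
  by rewrite mul1r subr0 mul1r mulfV ?gt_eqF // mul0r sub0r opprK.
have /andP[y0 _] := ncf_rem_itv _ _ n.+1 irr.
have y_neq0 := lt0r_neq0 y0; have Vx := ncf_remV _ alpha n.
exists (D * ncf_rem alpha n.+1), (ncf_quot alpha n * p - p'), p.
rewrite [ncf_den _ n.+1]/= -/(ncf_rem alpha n.+1); split.
- exact: mulr_gt0.
- rewrite !intrB !intrM.
  have -> : ncf_rem alpha n.+1 = (ncf_quot alpha n)%:~R - (ncf_rem alpha n)^-1.
    by rewrite Vx subKr.
  by rewrite mulrBr DV DE; ring.
- by rewrite mulfK.
- rewrite -[RHS]det Vx !intrB !intrM; field.
  exact: y_neq0.
Qed.

(** The two quotients before [n.+2] bound [t], the two after it bound [s]. *)
Lemma ncf_grid_point (R : realType) (alpha gamma : R) (A : int) (n : nat) :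
  irrational alpha -> 1 <= A -> ncf_quot alpha n.+2 = 2 * A + 1 ->
  3 <= ncf_quot alpha n -> 3 <= ncf_quot alpha n.+1 ->
  3 <= ncf_quot alpha n.+3 -> 3 <= ncf_quot alpha n.+4 ->
  exists N m : int, let y := N%:~R * alpha - gamma - m%:~R in
    `|y| * n%:R <= 2 * A%:~R + 2 /\ `|N%:~R * y| <= C_bound (2 * A%:~R + 1).
Proof.
move=> irr A1 aA a0 a1 a3 a4.
have a2 i : 2 <= ncf_quot alpha i by exact: ncf_quot_ge2.
have [D [p [p' [D0 DE DV det]]]] := ncf_lattice _ alpha n.+2 irr.
have [q'0 q'q nq] := ncf_den_lt _ n.+2 a2.
have q'2 := ncf_den_le _ n a2 a0 a1.
set q := (ncf_den _ _).1 in DE det q'q nq q'2.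
set q' := (ncf_den _ _).2 in DV det q'0 q'q q'2.
clearbody q q'.
have s2 := ncf_rem_le _ alpha n.+3 irr a3 a4.
have /andP[s0 _] := ncf_rem_itv _ _ n.+3 irr.
have VE := ncf_remV _ alpha n.+2; rewrite {}VE aA in DV det.
set s := ncf_rem alpha n.+3 in s2 s0 DV det; clearbody s.
have q0 : 0 < q%:~R :> R by rewrite ltr0z; lia.
pose t : R := q'%:~R / q%:~R.
have q'E : q'%:~R = t * q%:~R :> R by rewrite /t divfK // gt_eqF.
have s01 : 0 <= s <= 2 / 5 by rewrite s2 ltW.
have t01 : 0 <= t <= 2 / 5.
  apply/andP; split; first by rewrite /t divr_ge0 ?(ltW q0) ?ler0z.
  rewrite /t ler_pdivrMr //.
  by move: q'2; rewrite -(ler_int R) !intrM; clear; lra.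
have aE : (2 * A + 1)%:~R = 2 * A%:~R + 1 :> R by rewrite intrD intrM.
rewrite aE in DV det.
have det' : q%:~R * D * (2 * A%:~R + 1 - s - t) = 1.
  by rewrite -[RHS]det q'E; ring.
have [k [l []]] := @grid_point R A s t (gamma / D) A1 s01 t01.
set X := _ + _ * t; set Y := _ + _ - gamma / D => Yle XY.
have NE : (k * q + l * q')%:~R = q%:~R * X.
  by rewrite intrD !intrM q'E /X; ring.
have yE : (k * q + l * q')%:~R * alpha - gamma - (k * p + l * p')%:~R = D * Y.
  have -> : D * Y = k%:~R * D + l%:~R * (D * (2 * A%:~R + 1 - s)) - gamma.
    by rewrite /Y; field; rewrite gt_eqF.
  by rewrite DV DE !intrD !intrM; ring.
exists (k * q + l * q'), (k * p + l * p').
rewrite yE NE; split.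
- have A1R : 1 <= A%:~R :> R by rewrite ler1z.
  have [t0 t1] := andP t01.
  have nqR : n%:R <= q%:~R :> R.
    by rewrite -[n%:R]/(n%:Z%:~R) ler_int; clear -nq; lia.
  (* Here [1 / D = q (a - s - t)], with [q >= n] and [a - s - t >= 1]. *)
  have Dn : D * n%:R <= 1.
    rewrite -[leRHS]det' -[leLHS]mul1r.
    rewrite [leRHS](_ : _ = (2 * A%:~R + 1 - s - t) * (D * q%:~R)).
      apply: ler_pM => //; first by rewrite mulr_ge0 ?(ltW D0) ?ler0n.
        by clear -A1R s2 t1; lra.
      by apply: ler_wpM2l; first exact: ltW.
    by ring.
  rewrite normrM (gtr0_norm D0) mulrAC -[leRHS]mul1r.
  apply: ler_pM => //; first by rewrite mulr_ge0 ?(ltW D0) ?ler0n.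
  by apply: le_trans Yle _; lra.
- have qD0 : 0 <= q%:~R * D by rewrite mulr_ge0 ?(ltW q0) ?(ltW D0).
  rewrite mulrACA normrM (ger0_norm qD0) -[leRHS]mulr1 -[X in _ <= _ * X]det' [leRHS]mulrCA.
  exact: ler_wpM2l.
Qed.

(** * Separation from the integers and conclusion *)

Lemma dist_int_le (R : realType) (x : R) (m : int) :
  dist_int x <= `|x - m%:~R|.
Proof. by apply: ge_inf; [exists 0 => _ [k _ <-] | exists m]. Qed.

Lemma int_separated (R : realType) (x : R) : (forall m : int, x <> m%:~R) ->
  exists2 e : R, 0 < e & forall m : int, e <= `|x - m%:~R|.
Proof.
move=> xZ; have := floor_itv x; rewrite intrD1 => /andP[lx xr].
have {}lx : (Num.floor x)%:~R < x.
  by rewrite lt_neqAle lx andbT; apply/eqP => /esym; exact: xZ.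
exists (Num.min (x - (Num.floor x)%:~R) ((Num.floor x)%:~R + 1 - x)).
  by rewrite lt_min; apply/andP; split; lra.
move=> m; rewrite ge_min; have [mx|] := leP m (Num.floor x).
  rewrite -(ler_int R) in mx; apply/orP; left.
  by apply: le_trans (ler_norm _); lra.
rewrite -lezD1 -(ler_int R) intrD => mx; apply/orP; right.
by rewrite distrC; apply: le_trans (ler_norm _); lra.
Qed.

(** Only finitely many [n] occur, each at positive distance; a closer approximation must therefore
    have [|n| >= N]. *)
Lemma bounded_multiples_separated (R : realType) (alpha gamma : R) (N : nat) :
  ~ (exists p q : int, gamma = p%:~R + q%:~R * alpha) ->
  exists2 e : R, 0 < e & forall n m : int, (`|n| < N)%N ->
    e <= `|n%:~R * alpha - gamma - m%:~R|.
Proof.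
move=> gZ; have nZ n m : n%:~R * alpha - gamma <> m%:~R.
  move=> nE; apply: gZ; exists (- m), n; rewrite intrN -nE; ring.
elim: N => [|N [e e0 He]]; first by exists 1.
have [e1 e10 He1] := int_separated _ _ (nZ N).
have [e2 e20 He2] := int_separated _ _ (nZ (- N%:Z)).
exists (Num.min e (Num.min e1 e2)); first by rewrite !lt_min e0 e10.
move=> n m; rewrite ltnS leq_eqVlt => /orP[/eqP nN|nN]; rewrite !ge_min.
  have [->|->] : n = N \/ n = - N%:Z by lia.
    by rewrite He1 orbT.
  by rewrite He2 !orbT.
by rewrite He.
Qed.

Theorem theorem1 (R : realType) (alpha : R) (r : nat) :
  irrational alpha ->
  limn_einf (fun i : nat => ((ncf_quot alpha i)%:~R : R)%:E) = (r%:R : R)%:E ->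
  odd r ->
  (rho alpha <= (C_bound (r%:R : R))%:E)%E.
Proof.
move=> irr liminf_r r_odd.
have [freq [N0 evtl]] := limn_einf_int R (ncf_quot alpha) r%:Z liminf_r.
have r3 : (3 <= r)%N.
  have [n [_ an]] := freq 0.
  have := le_trans (ncf_quot_ge2 _ _ n irr) an; rewrite lez_nat.
  by case: r r_odd {liminf_r freq evtl an} => [|[|[|]]].
have [A rE] : exists A : nat, r = (2 * A + 1)%N.
  by exists r./2; rewrite -[LHS]odd_double_half r_odd mul2n addn1.
have A1 : 1 <= A%:Z by rewrite lez_nat; lia.
apply: ge_ereal_sup => _ [gamma [_ gZ] <-].
apply: ge_ereal_sup => _ [N _ <-].
have [e e0 He] := bounded_multiples_separated _ _ _ N gZ.
(* The first summand forces [(2 A + 2) / i < e], the second puts [i] where all quotients are at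
   least [r], and [2] absorbs the index shift in [ncf_grid_point]. *)
pose k := (Num.bound ((2 * A%:~R + 2) / e) + N0 + 2)%N.
have [[|[|i]] [ki ai]] := freq k; try by move: ki; rewrite /k addn2.
have a3 j : (N0 <= j)%N -> 3 <= ncf_quot alpha j.
  by move=> /evtl; apply: le_trans.
have iN : (N0 <= i)%N by move: ki; rewrite /k; lia.
have aE : ncf_quot alpha i.+2 = 2 * A%:Z + 1.
  apply/eqP; rewrite eq_le; have := evtl i.+2 (leqW (leqW iN)).
  by move: ai; rewrite rE => ? ?; apply/andP; split; lia.
have [n [m [yi ny]]] := ncf_grid_point _ alpha gamma A%:Z i irr A1 aE
  (a3 _ iN) (a3 _ (leqW iN)) (a3 _ (leqW (leqW (leqW iN))))
  (a3 _ (leqW (leqW (leqW (leqW iN))))).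
have nN : (N <= `|n|)%N.
  rewrite leqNgt; apply/negP => /(He n m) ey.
  have : (2 * A%:~R + 2) / e < i%:R.
    apply: lt_le_trans (archi_boundP _) _.
      by rewrite divr_ge0 ?(ltW e0) // addr_ge0 ?mulr_ge0 ?ler0z.
    by rewrite ler_nat; move: ki; rewrite /k; lia.
  rewrite ltr_pdivrMr // => lt_i.
  have : e * i%:R <= 2 * A%:~R + 2 by apply: le_trans yi; apply: ler_wpM2r.
  by rewrite mulrC leNgt lt_i.
apply: le_trans (ereal_inf_lbound _) _; first by exists n.
rewrite lee_fin.
have -> : r%:R = 2 * A%:~R + 1 :> R by rewrite rE natrD natrM.
apply: le_trans ny; rewrite normrM; apply: ler_wpM2l => //.
exact: dist_int_le.
Qed.
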